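(* Let $\Gamma$ be a finite simplicial graph with vertex set $V$, and let $\mathcal G=\mathcal G(\Gamma,\{G_v\}_{v\in V})$ be the graph product of nontrivial groups $G_v$ over $\Gamma$. Let $N<\mathcal G$ be a finitely generated full normal subgroup of $\mathcal G$. Suppose that for each central vertex $v$ of $\Gamma$, every proper quotient of $G_v$ (i.e. every quotient $G_v/M$ with $M\neq 1$ a normal subgroup of $G_v$) is both abelian-by-finite and finite-by-abelian. Then $\mathcal G/N$ is both finite-by-abelian and abelian-by-finite, i.e. there are exact sequences $$1\to A\to \mathcal G/N\to Q\to 1 \qquad\text{and}\qquad 1\to Q'\to \mathcal G/N\to A'\to 1$$ with $A,A'$ abelian and $Q,Q'$ finite.
   Context: Graphs are simplicial (no loops, no multiple edges). The graph product $\mathcal G(\Gamma,\{G_v\})$ is the quotient of the free product $\ast_{v\in V}G_v$ by the relations $[g,h]=1$ for all $g\in G_u$, $h\in G_w$ whenever $u,w$ are adjacent in $\Gamma$. For an induced subgraph $\Delta$, $\mathcal G(\Delta)$ denotes the subgroup generated by the vertex groups of $\Delta$. The join of graphs $\Gamma_1,\Gamma_2$ is their disjoint union with every vertex of $\Gamma_1$ joined to every vertex of $\Gamma_2$. A vertex $v$ is central if it is adjacent to every other vertex of $\Gamma$. Every finite graph $\Gamma$ decomposes as a join of induced subgraphs $\Gamma_1,\dots,\Gamma_k$, each of which is not a join of two nonempty subgraphs; this yields $\mathcal G=\mathcal G(\Gamma_1)\times\cdots\times\mathcal G(\Gamma_k)$. A subgroup $N<\mathcal G$ is full if $N\cap \mathcal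 G(\Gamma_i)\neq 1$ for every $i\in\{1,\dots,k\}$. *)

(* Defs.v *)
From HB Require Import structures.
From mathcomp Require Import all_boot.

Set Implicit Arguments.
Unset Strict Implicit.
Unset Printing Implicit Defensive.

Local Open Scope group_scope.

Section GroupNotions.
Variable G : groupType.

Definition is_subgroup (S : G -> Prop) : Prop :=
  [/\ S 1, (forall x y, S x -> S y -> S (x * y)) & (forall x, S x -> S x^-1)].

Definition is_normal (S : G -> Prop) : Prop :=
  is_subgroup S /\ (forall x g, S x -> S (x ^ g)).

Definition gen (A : G -> Prop) : G -> Prop :=
  fun x => forall S, is_subgroup S -> (forall a, A a -> S a) -> S x.

Definition finite_set (S : G -> Prop) : Prop :=
  exists s : seq G, forall x, S x -> x \in s.

Definition finite_index (S : G -> Prop) : Prop :=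
  exists s : seq G, forall x, exists2 g, g \in s & S (g^-1 * x).

Definition abelian_by_finite : Prop :=
  exists A : G -> Prop,
    [/\ is_normal A, (forall x y, A x -> A y -> commute x y) & finite_index A].

(** exact sequence 1 -> F -> G -> A -> 1, F finite, A = G/F abelian
    (G/F abelian  <->  every commutator lies in F) *)
Definition finite_by_abelian : Prop :=
  exists F : G -> Prop,
    [/\ is_normal F, finite_set F & (forall x y, F [~ x, y])].

End GroupNotions.

Definition is_hom (G H : groupType) (f : G -> H) : Prop :=
  forall x y, f (x * y) = f x * f y.

Definition simplicial (V : finType) (e : rel V) : Prop :=
  symmetric e /\ irreflexive e.

Definition central_vertex (V : finType) (e : rel V) (v : V) : Prop :=
  forall w, w != v -> e v w.

(** [GG] together with [iota] is the graph product of the [Gv] over (V,e):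
    universal property of the quotient of the free product of the [Gv] by the
    relations [g,h] = 1 for g in G_u, h in G_w, u ~ w. *)
Definition is_graph_product (V : finType) (e : rel V) (Gv : V -> groupType)
    (GG : groupType) (iota : forall v, Gv v -> GG) : Prop :=
  [/\ (forall v, is_hom (iota v)),
      (forall u w, e u w -> forall (g : Gv u) (h : Gv w), commute (iota u g) (iota w h))
    & (forall (H : groupType) (phi : forall v, Gv v -> H),
         (forall v, is_hom (phi v)) ->
         (forall u w, e u w -> forall (g : Gv u) (h : Gv w), commute (phi u g) (phi w h)) ->
         exists! psi : GG -> H, is_hom psi /\ (forall v g, psi (iota v g) = phi v g))].

(** Join decomposition: the factors Gamma_1..Gamma_k of the (unique) join
    decomposition into join-irreducible induced subgraphs are the connected
    components of the complement graph.  [cocomp e u v]: v lies in the same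
    factor as u. *)
Definition cocomp (V : finType) (e : rel V) (u v : V) : bool :=
  connect [rel x y | (x != y) && ~~ e x y] u v.

Definition factor_subgroup (V : finType) (e : rel V) (Gv : V -> groupType)
    (GG : groupType) (iota : forall v, Gv v -> GG) (u : V) : GG -> Prop :=
  gen (fun x => exists v (g : Gv v), cocomp e u v /\ x = iota v g).

Definition full (V : finType) (e : rel V) (Gv : V -> groupType)
    (GG : groupType) (iota : forall v, Gv v -> GG) (N : GG -> Prop) : Prop :=
  forall u : V, exists x, [/\ x != 1, N x & factor_subgroup e iota u x].

Definition finitely_generated (G : groupType) (N : G -> Prop) : Prop :=
  exists s : seq G, forall x, N x <-> gen (fun y => y \in s) x.

(* Main.v *)
Require Import Defs.
From HB Require Import structures.
From mathcomp Require Import all_boot.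
From mathcomp Require Import boolp.

(** Let [u] be a vertex that is not central and [C] the subgroup generated by
    the vertex groups of its link. The elements of the graph product whose
    normal form starts with a nontrivial syllable of [Gv u] form a set [X] that
    behaves like a half-space of the Bass-Serre tree of the splitting over [C]:
    translates of [X] are nested, and multiplying on the right by a fixed element
    changes membership in [X] only on finitely many cosets of [C].
    If some coset of [N] lay on one side of [X], then [N] would permute a finite
    chain of half-spaces, hence be contained in [C]; normality and fullness
    exclude this, since then [N] would centralize, and be contained in the star
    of, every vertex of the join factor of [u]. So every coset of [N] crosses [X],
    and as [N] is finitely generated it crosses at finitely many places modulo
    [N], which says that [C] has finite index image in the quotient. Hence the
    image of [Gv u] is centralized by a finite index subgroup, the noncentral
    vertices generate a central-by-finite group, and Schur's theorem applies to
    it. The central vertices contribute commuting factors that have both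
    properties by hypothesis. *)

Set Implicit Arguments.
Unset Strict Implicit.
Unset Printing Implicit Defensive.

Local Open Scope group_scope.

(** * Subgroups given by predicates *)

Lemma hom1 (G H : groupType) (f : G -> H) : is_hom f -> f 1 = 1.
Proof. by move=> fM; apply: (mulgI (f 1)); rewrite -fM !mulg1. Qed.

Lemma homV (G H : groupType) (f : G -> H) x : is_hom f -> f x^-1 = (f x)^-1.
Proof.
by move=> fM; apply: (mulgI (f x)); rewrite -fM !mulgV (hom1 fM).
Qed.

Lemma homJ (G H : groupType) (f : G -> H) x y : is_hom f -> f (x ^ y) = f x ^ f y.
Proof. by move=> fM; rewrite !conjgE !fM homV. Qed.

Section Subgroups.
Variable G : groupType.
Implicit Types (A S : G -> Prop) (x y : G).

Lemma gen_subgroup A : is_subgroup (gen A).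
Proof.
split=> [|x y Ax Ay|x Ax] S Ssub AS; have [S1 SM SV] := Ssub => //.
- by apply: SM; [apply: Ax | apply: Ay].
- by apply: SV; apply: Ax.
Qed.

Lemma gen_mem A x : A x -> gen A x.
Proof. by move=> Ax S _; apply. Qed.

Lemma gen_mul A x y : gen A x -> gen A y -> gen A (x * y).
Proof. by have [_ H _] := gen_subgroup A; apply: H. Qed.

Lemma gen1 A : gen A 1.
Proof. by have [H _ _] := gen_subgroup A. Qed.

Lemma subgroup_mulr S x y : is_subgroup S -> S x -> S (x * y) <-> S y.
Proof.
move=> [_ SM SV] Sx; split=> [Sxy|]; last exact: SM.
by rewrite -(mulKg x y); apply: SM => //; apply: SV.
Qed.

Lemma subgroup_inv S x : is_subgroup S -> S x^-1 <-> S x.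
Proof.
by move=> [_ _ SV]; split=> [|/SV//]; rewrite -{2}(invgK x) => /SV.
Qed.

Lemma subgroup_exp S x n : is_subgroup S -> S x -> S (x ^+ n).
Proof.
move=> [S1 SM _] Sx; elim: n => [|n IHn]; first by rewrite expg0.
by rewrite expgS; apply: SM.
Qed.

Lemma subgroup_conj S x y : is_subgroup S -> S x -> S y -> S (x ^ y).
Proof.
move=> [_ SM SV] Sx Sy; rewrite conjgE.
exact: SM (SV _ Sy) (SM _ _ Sx Sy).
Qed.

Lemma subgroup_comm S x y : is_subgroup S -> S x -> S y -> S [~ x, y].
Proof.
move=> Ssub Sx Sy; have [_ SM SV] := Ssub; rewrite commgEl.
by apply: SM; [apply: SV | apply: subgroup_conj].
Qed.

Lemma subgroup_cent A : is_subgroup (fun x => forall a, A a -> commute a x).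
Proof.
split=> [a _|x y cx cy a Aa|x cx a Aa]; first exact: commute1.
- by apply: commuteM; [apply: cx | apply: cy].
- by apply: commuteV; apply: cx.
Qed.

Lemma gen_commute A (B : G -> Prop) :
    (forall a b, A a -> B b -> commute a b) ->
  forall x y, gen A x -> gen B y -> commute x y.
Proof.
move=> cAB x y Ax By; apply/commute_sym.
apply: (Ax (fun x => forall y, gen B y -> commute y x)) By => [|a Aa {}y By].
  exact: subgroup_cent.
apply/commute_sym; apply: (By (fun y => commute a y)) => [|b]; last exact: cAB.
split=> [|z t cz ct|z cz]; first exact: commute1.
- exact: commuteM.
- exact: commuteV.
Qed.

Lemma gen_ind_left A (P : G -> Prop) :
    (forall a, A a -> A a^-1) -> P 1 ->
    (forall a x, A a -> P x -> P (a * x)) ->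
  forall x, gen A x -> P x.
Proof.
(* The elements whose left translation preserves [P] in both directions form a subgroup; asking for
   an equivalence is what yields closure under inverses. *)
move=> AV P1 PM x /(_ (fun x => forall y, P y <-> P (x * y))) H.
rewrite -(mulg1 x); apply/(H _ _ 1) => //; last first.
  move=> a Aa y; split=> [|Pay]; first exact: PM.
  by rewrite -(mulKg a y); apply: PM => //; apply: AV.
split=> [y|{H}x1 x2 H1 H2 y|{H}x1 H1 y]; first by rewrite mul1g.
- by rewrite -mulgA -H1.
- by rewrite (H1 (_ * y)) mulVKg.
Qed.

End Subgroups.

(** * Subgroups as groups in their own right *)

Section SubgroupType.
Variables (G : groupType) (S : G -> Prop) (Ssub : is_subgroup S).

(** Membership is made boolean by classical reflection, as subtypes require; the proof argument
    makes the type remember that [S] is a subgroup, so that its group structure can be inferred. *)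
Definition subgroup_pred of is_subgroup S : {pred G} := fun x => `[< S x >].

Record subgroup_type := SubgroupType {
  subgroup_val :> G; _ : subgroup_pred Ssub subgroup_val }.

HB.instance Definition _ := [isSub for subgroup_val].
HB.instance Definition _ := [Choice of subgroup_type by <:].

Fact subgroup_pred_closed : group_closed (subgroup_pred Ssub).
Proof.
have [S1 SM SV] := Ssub.
split; first exact/asboolP.
by move=> x y /asboolP Sx /asboolP Sy; apply/asboolP; apply: SM => //; apply: SV.
Qed.

HB.instance Definition _ :=
  SubChoice_isSubGroup.Build G (subgroup_pred Ssub) subgroup_type
    subgroup_pred_closed.

Lemma subgroup_valP (x : subgroup_type) : S (val x).
Proof. by apply/asboolP; apply: (valP x). Qed.

Definition to_subgroup x (Sx : S x) : subgroup_type :=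
  SubgroupType (introT (asboolP (S x)) Sx).

End SubgroupType.

(** * Finite index *)

Section FiniteIndex.
Variable G : groupType.
Implicit Types (H K : G -> Prop).

(** The representatives are taken in [H], and [K] need not lie in [H]: for subgroups this says that
    the intersection of [H] and [K] has finite index in [H]. *)
Definition finite_index_in H K :=
  exists s : seq G, forall x, H x -> exists2 g, g \in s & H g /\ K (g^-1 * x).

(** Each listed coset of [K] that meets [H] gets a new representative in [H]; the other cosets are
    dropped. *)
Lemma finite_index_inI H K :
  is_subgroup K -> finite_index K -> finite_index_in H K.
Proof.
move=> [_ KM KV] [s Ks].
suff [s' Hs'] : exists s' : seq G, forall g x, g \in s -> H x -> K (g^-1 * x) ->
    exists2 g', g' \in s' & H g' /\ K (g'^-1 * x).
  by exists s' => x Hx; have [g gs Kgx] := Ks x; apply: Hs' Kgx.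
elim: s {Ks} => [|g s [s' IHs]]; first by exists [::].
have [[h [Hh Kh]]|noh] := pselect (exists h, H h /\ K (g^-1 * h)).
  exists (h :: s') => k x; rewrite inE => /predU1P[-> Hx Kx|ks Hx Kx].
    exists h; rewrite ?mem_head //; split=> //.
    have -> : h^-1 * x = (g^-1 * h)^-1 * (g^-1 * x).
      by rewrite invgM invgK -mulgA mulVKg.
    by apply: KM => //; apply: KV.
  by have [g' gs' ?] := IHs k x ks Hx Kx; exists g'; rewrite // inE gs' orbT.
exists s' => k x; rewrite inE => /predU1P[-> Hx Kx|]; last exact: IHs.
by case: noh; exists x.
Qed.

Lemma finite_indexI H K : is_subgroup H -> is_subgroup K ->
  finite_index H -> finite_index K -> finite_index (fun x => H x /\ K x).
Proof.
move=> [_ HM HV] Ksub [s Hs] Kfi.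
have [t Kt] := finite_index_inI H Ksub Kfi.
exists [seq g * h | g <- s, h <- t] => x.
have [g gs Hgx] := Hs x; have [h ht [Hh Khx]] := Kt _ Hgx.
exists (g * h); first exact: allpairs_f.
by rewrite invgM -mulgA; split=> //; apply: HM => //; apply: HV.
Qed.

Lemma finite_index_bigcap (I : finType) (P : pred I) (K : I -> G -> Prop) :
    (forall i, P i -> is_subgroup (K i)) ->
    (forall i, P i -> finite_index (K i)) ->
  finite_index (fun x => forall i, P i -> K i x).
Proof.
move=> Ksub Kfi.
suff [_ [s Hs]] : is_subgroup (fun x => forall i, P i -> i \in enum I -> K i x) /\
    finite_index (fun x => forall i, P i -> i \in enum I -> K i x).
  exists s => x; have [g gs Hg] := Hs x; exists g => // i Pi.
  by apply: Hg; rewrite ?mem_enum.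
elim: (enum I) => [|i r [[H1 HM HV] IHr]].
  by split=> //; exists [:: 1] => x; exists 1; rewrite ?inE.
have Esub : is_subgroup (fun x => forall j, P j -> j \in i :: r -> K j x).
  split=> [j Pj _|x y Hx Hy j Pj jr|x Hx j Pj jr]; have [K1 KM KV] := Ksub j Pj.
  - exact: K1.
  - by apply: KM; [apply: Hx | apply: Hy].
  - by apply: KV; apply: Hx.
split=> //; have [Pi|nPi] := boolP (P i); last first.
  have [s Hs] := IHr; exists s => x; have [g gs Hg] := Hs x.
  exists g => // j Pj; rewrite inE => /predU1P[ji|]; last exact: Hg.
  by rewrite ji (negPf nPi) in Pj.
have [s Hs] := finite_indexI (Ksub i Pi) (And3 H1 HM HV) (Kfi i Pi) IHr.
exists s => x; have [g gs [Kg Hg]] := Hs x; exists g => // j Pj.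
by rewrite inE => /predU1P[->|]; [apply: Kg | apply: Hg].
Qed.

Lemma finite_index_sub H K :
  (forall x, H x -> K x) -> finite_index H -> finite_index K.
Proof.
move=> HK [s Hs]; exists s => x; have [g gs Hg] := Hs x.
by exists g => //; apply: HK.
Qed.

(** Two of the powers with exponents from [0] to [size s] share a left coset of [K]. The bound on
    [p] later provides an exponent uniform in [x]. *)
Lemma expg_pigeonhole K (s : seq G) x : is_subgroup K ->
    (forall k, exists2 g, g \in s & K (g^-1 * x ^+ k)) ->
  exists p, [/\ 0 < p, p <= size s & K (x ^+ p)].
Proof.
move=> Ksub Ks; have [_ KM KV] := Ksub.
have [k|f fP] := @choice _ _ (fun k g => g \in s /\ K (g^-1 * x ^+ k)).
  by have [g gs Kg] := Ks k; exists g.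
pose r := map f (iota 0 (size s).+1).
have : ~~ uniq r.
  apply/negP => /uniq_leq_size => /(_ s); rewrite size_map size_iota ltnn => H.
  by suff: false by []; apply: H => _ /mapP[k _ ->]; have [] := fP k.
case/(uniqPn 1) => i [j [ij]]; rewrite size_map size_iota => js.
rewrite !(nth_map 0) ?size_iota ?(ltn_trans ij js) //.
rewrite !nth_iota ?(ltn_trans ij js) // !add0n => fij.
exists (j - i)%N; rewrite subn_gt0 ij; split=> //.
  by rewrite -ltnS; apply: leq_ltn_trans (leq_subr _ _) js.
have [[_ Ki] [_ Kj]] := (fP i, fP j).
have -> : x ^+ (j - i) = ((f i)^-1 * x ^+ i)^-1 * ((f j)^-1 * x ^+ j).
  rewrite invgM invgK fij -mulgA mulVKg.
  by rewrite -{2}(subnKC (ltnW ij)) expgnDr mulKg.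
by apply: KM => //; apply: KV.
Qed.

End FiniteIndex.

(** * Schur's theorem *)

Lemma count_bounded_size (T : eqType) (r w : seq T) n :
    (forall x, x \in w -> x \in r) -> (forall x, x \in r -> count_mem x w <= n) ->
  size w <= size r * n.
Proof.
elim: r w => [|x r IHr] w wr cw.
  by case: w wr cw => // y w /(_ y (mem_head _ _)).
rewrite -(count_predC (pred1 x)) mulSn leq_add ?cw ?mem_head //.
rewrite -size_filter; apply: IHr => [y|y yr].
  by rewrite mem_filter /= => /andP[/negPf yx /wr]; rewrite inE yx.
rewrite count_filter; apply: leq_trans (cw y _); last by rewrite inE yr orbT.
by apply: sub_count => z /andP[].
Qed.

Section Schur.
Variables (G : groupType) (H Z : G -> Prop).
Hypotheses (Hsub : is_subgroup H) (Zsub : is_subgroup Z).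
Hypothesis ZC : forall z x, Z z -> H x -> commute z x.
Hypothesis Zfi : finite_index_in H Z.

Definition commutator_in c := exists x y, [/\ H x, H y & c = [~ x, y]].

Definition word_prod (w : seq G) := foldr (fun x y => x * y) 1 w.

Definition commutator_word (w : seq G) := forall c, c \in w -> commutator_in c.

Lemma word_prod_cat w1 w2 :
  word_prod (w1 ++ w2) = word_prod w1 * word_prod w2.
Proof. by elim: w1 => [|x w IHw] /=; rewrite ?mul1g // IHw mulgA. Qed.

Lemma word_prod_nseq n c : word_prod (nseq n c) = c ^+ n.
Proof. by elim: n => [|n IHn]; rewrite ?expg0 // expgS /= IHn. Qed.

Lemma commutator_in_sub c : commutator_in c -> H c.
Proof. by case=> x [y [Hx Hy ->]]; apply: subgroup_comm. Qed.

Lemma commutator_in_conj c h : commutator_in c -> H h -> commutator_in (c ^ h).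
Proof.
case=> x [y [Hx Hy ->]] Hh.
by exists (x ^ h), (y ^ h); rewrite conjRg; split=> //; apply: subgroup_conj.
Qed.

Lemma commutator_mulZ a b z : H a -> H b -> Z z -> [~ a * z, b] = [~ a, b].
Proof.
move=> Ha Hb Zz; rewrite commgEl conjMg invgM -mulgA (mulgA a^-1) -commgEl.
have -> : z ^ b = z by apply/conjg_fixP/commgP; apply: ZC.
rewrite -conjgE; apply/conjg_fixP/commgP/commute_sym.
by apply: ZC => //; apply: subgroup_comm.
Qed.

(** A commutator depends only on the cosets of its entries modulo [Z]; inverting swaps the entries,
    so [commutator_mulZ] serves for both. *)
Lemma commutators_finite :
  exists T : seq G, forall c, commutator_in c -> c \in T.
Proof.
have [s sP] := Zfi; have [H1 HM HV] := Hsub.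
exists [seq [~ g, h] | g <- s, h <- s] => _ [x [y [Hx Hy ->]]].
have [g gs [Hg Zgx]] := sP x Hx; have [h hs [Hh Zhy]] := sP y Hy.
suff -> : [~ x, y] = [~ g, h] by apply: allpairs_f.
rewrite -(mulVKg g x) commutator_mulZ // -invgR -(mulVKg h y).
by rewrite commutator_mulZ // invgR.
Qed.

(** The pigeonhole exponent varies with [x] but never exceeds the number of representatives, so the
    factorial of that number is a multiple of all of them. *)
Lemma central_exponent : exists2 n, 0 < n & forall x, H x -> Z (x ^+ n).
Proof.
have [s sP] := Zfi; exists (size s)`! => [|x Hx]; first exact: fact_gt0.
have [k|p [p_gt0 ps Zp]] := @expg_pigeonhole _ Z s x Zsub.
  by have [|g gs []] := sP (x ^+ k); [apply: subgroup_exp | exists g].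
have /dvdnP[m ->] : p %| (size s)`! by apply: dvdn_fact; rewrite p_gt0.
by rewrite mulnC expgnA; apply: subgroup_exp.
Qed.

(* Since [c ^+ m.+1] is central,
   [c ^+ m.+2 = x^-1 * c ^+ m.+1 * x ^ y = [~ x * x, y] * (c ^ (x ^ y)) ^+ m]. *)
Lemma commutator_expg_shorten c m : commutator_in c -> Z (c ^+ m.+1) ->
  exists w, [/\ commutator_word w, size w = m.+1 & c ^+ m.+2 = word_prod w].
Proof.
move=> cC Zc; have [x [y [Hx Hy Ec]]] := cC; have [_ HM _] := Hsub.
exists ([~ x * x, y] :: nseq m (c ^ (x ^ y))); split.
- move=> d; rewrite inE => /predU1P[->|]; first by exists (x * x), y; split; auto.
  case/nseqP=> -> _; apply: commutator_in_conj => //; exact: subgroup_conj.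
- by rewrite /= size_nseq.
- rewrite /= word_prod_nseq -conjXg expgSr {2}Ec commgEl mulgA.
  have [_ _ HV] := Hsub.
  rewrite (ZC Zc (HV _ Hx)) expgS {1}Ec !commgEl conjMg invgM -!mulgA.
  by rewrite [c ^+ m * _]conjgC {1}conjgE -!mulgA.
Qed.

(** Copies of [c] are moved to the front; the letters they pass are conjugated by a power of [c] and
    remain commutators, so no length is gained. *)
Lemma commutator_word_extract c k w : commutator_word w -> k <= count_mem c w ->
  exists w', [/\ commutator_word w', (size w' + k)%N = size w
               & word_prod w = c ^+ k * word_prod w'].
Proof.
have [H1 HM HV] := Hsub.
elim: w k => [|t w IHw] k Cw.
  by rewrite leqn0 => /eqP->; exists [::]; rewrite mul1g.
have Cw' : commutator_word w by move=> d dw; apply: Cw; rewrite inE dw orbT.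
have Ct : commutator_in t by apply: Cw; rewrite mem_head.
case: k => [|k]; first by exists (t :: w); rewrite addn0 mul1g.
rewrite [count_mem _ _]/=; have [-> |tc] := eqVneq t c.
  rewrite add1n ltnS => /(IHw _ Cw')[w' [Cw1 sw Ew]]; exists w'.
  by rewrite addnS sw /= Ew expgS mulgA.
rewrite add0n => kw; have [w' [Cw1 sw Ew]] := IHw _ Cw' kw.
exists (t ^ (c ^+ k.+1) :: w'); split=> /=.
- move=> d; rewrite inE => /predU1P[->|/Cw1//].
  apply: commutator_in_conj => //; apply: subgroup_exp => //.
  by apply/commutator_in_sub/Cw'; rewrite -has_pred1 has_count (leq_trans _ kw).
- by rewrite addSn sw.
- by rewrite Ew mulgA [t * _]conjgC -[LHS]mulgA.
Qed.

(** With [n.+1] a central exponent, a word longer than [size T * n.+1] repeats some commutator at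
    least [n.+2] times. Gathering these copies and shortening their power saves one letter; then
    induct on the length. *)
Lemma commutator_word_bounded : exists n, forall w, commutator_word w ->
  exists w', [/\ commutator_word w', size w' <= n & word_prod w' = word_prod w].
Proof.
have [T TP] := commutators_finite; have [[//|n] _ Zn] := central_exponent.
exists (size T * n.+1)%N => w.
have [k] := ubnP (size w); elim: k w => // k IHk w wk Cw.
have [wT|] := leqP (size w) (size T * n.+1); first by exists w.
rewrite ltnNge => /negP wT.
have [c cT] : exists2 c, c \in T & n.+1 < count_mem c w.
  apply: contrapT => nc; apply: wT; apply: count_bounded_size => [x /Cw/TP//|x xT].
  by rewrite leqNgt; apply/negP => cx; apply: nc; exists x.
move=> cw; have Cc : commutator_in c.
  by apply: Cw; rewrite -has_pred1 has_count (leq_trans _ cw).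
have [w1 [Cw1 sw1 Ew1]] := commutator_word_extract Cw cw.
have [w2 [Cw2 sw2 Ew2]] :=
  commutator_expg_shorten Cc (Zn _ (commutator_in_sub Cc)).
have [|d|w' [Cw' sw' Ew']] := IHk (w2 ++ w1).
- by rewrite size_cat sw2 addnC -addnS sw1.
- by rewrite mem_cat => /orP[/Cw2|/Cw1].
by exists w'; rewrite Ew' word_prod_cat -Ew2 Ew1.
Qed.

Lemma bounded_words_finite (T : seq G) n : exists L : seq G,
  forall w : seq G, {subset w <= T} -> size w <= n -> word_prod w \in L.
Proof.
elim: n => [|n [L LP]].
  by exists [:: 1] => [[|//]] _ _; rewrite inE.
exists (1 :: [seq t * x | t <- T, x <- L]) => [[|t w]] wT sw.
  by rewrite mem_head.
rewrite inE; apply/orP; right; apply: allpairs_f.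
  by apply: wT; rewrite mem_head.
by apply: LP => // x xw; apply: wT; rewrite inE xw orbT.
Qed.

Lemma schur : exists F : G -> Prop,
  [/\ is_subgroup F, (forall x, F x -> H x), (forall x h, F x -> H h -> F (x ^ h)),
      finite_set F & forall x y, H x -> H y -> F [~ x, y]].
Proof.
have [H1 HM HV] := Hsub.
(* This is the derived subgroup of [H]. It is finite because boundedly many factors, drawn from a
   finite set, suffice for each element. *)
exists (fun x => exists2 w, commutator_word w & x = word_prod w); split.
- split; first by exists [::].
    move=> _ _ [w Cw ->] [w' Cw' ->]; exists (w ++ w'); last by rewrite word_prod_cat.
    by move=> c; rewrite mem_cat => /orP[/Cw|/Cw'].
  move=> _ [w Cw ->]; exists (rev (map (fun x => x^-1) w)).
    move=> c; rewrite mem_rev => /mapP[d /Cw[x [y [Hx Hy ->]]] ->].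
    by exists y, x; rewrite invgR.
  elim: w {Cw} => [|x w IHw]; first by rewrite invg1.
  by rewrite /= invgM IHw rev_cons -cats1 word_prod_cat /= mulg1.
- move=> _ [w Cw ->]; elim: w Cw => //= x w IHw Cw; apply: HM.
    by apply/commutator_in_sub/Cw; rewrite mem_head.
  by apply: IHw => c cw; apply: Cw; rewrite inE cw orbT.
- move=> _ h [w Cw ->] Hh; exists (map (conjg^~ h) w).
    by move=> c /mapP[d /Cw Cd ->]; apply: commutator_in_conj.
  by elim: w {Cw} => [|x w IHw] /=; rewrite ?conj1g // conjMg IHw.
- have [n nP] := commutator_word_bounded; have [T TP] := commutators_finite.
  have [L LP] := bounded_words_finite T n.
  exists L => _ [w Cw ->]; have [w' [Cw' sw' <-]] := nP w Cw.
  by apply: LP => // c /Cw'/TP.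
- move=> x y Hx Hy; exists [:: [~ x, y]]; last by rewrite /= mulg1.
  by move=> c; rewrite inE => /eqP->; exists x, y.
Qed.

End Schur.

(** * Commuting products *)

Section RelativeProperties.
Variable G : groupType.
Implicit Types (H K : G -> Prop).

(** Both properties are relativized to a subgroup of an ambient group, so that commuting factors can
    be multiplied inside one fixed group. *)
Definition abelian_by_finite_in H := exists A : G -> Prop,
  [/\ is_subgroup A, (forall x, A x -> H x),
      (forall x h, A x -> H h -> A (x ^ h)),
      (forall x y, A x -> A y -> commute x y) & finite_index_in H A].

Definition finite_by_abelian_in H := exists F : G -> Prop,
  [/\ is_subgroup F, (forall x, F x -> H x),
      (forall x h, F x -> H h -> F (x ^ h)),
      finite_set F & forall x y, H x -> H y -> F [~ x, y]].

Definition mul_set H K x := exists h k, [/\ H h, K k & x = h * k].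

Lemma mul_set_subgroup H K : is_subgroup H -> is_subgroup K ->
  (forall h k, H h -> K k -> commute h k) -> is_subgroup (mul_set H K).
Proof.
move=> [H1 HM HV] [K1 KM KV] cHK; split.
- by exists 1, 1; rewrite mulg1.
- move=> _ _ [h [k [Hh Kk ->]]] [h' [k' [Hh' Kk' ->]]].
  exists (h * h'), (k * k'); split; auto.
  by rewrite -!mulgA (mulgA k) -(cHK h' k) // -!mulgA.
- move=> _ [h [k [Hh Kk ->]]]; exists h^-1, k^-1; split; auto.
  by rewrite -invgM (cHK h k).
Qed.

Lemma mul_set_sub H K (H' K' : G -> Prop) :
    (forall x, H x -> H' x) -> (forall x, K x -> K' x) ->
  forall x, mul_set H K x -> mul_set H' K' x.
Proof.
by move=> HH' KK' x [h [k [Hh Kk ->]]]; exists h, k; split; auto.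
Qed.

Section Commuting.
Variables H K : G -> Prop.
Hypotheses (Hsub : is_subgroup H) (Ksub : is_subgroup K).
Hypothesis cHK : forall h k, H h -> K k -> commute h k.

Lemma conj_commuting h k a b : H h -> K k -> H a -> K b ->
  (h * k) ^ (a * b) = h ^ a * k ^ b.
Proof.
move=> Hh Kk Ha Kb; rewrite conjMg !conjgM.
have -> : (h ^ a) ^ b = h ^ a.
  by apply/conjg_fixP/commgP/cHK => //; apply: subgroup_conj.
by have -> : k ^ a = k by apply/conjg_fixP/commgP/commute_sym/cHK.
Qed.

Lemma mul_set_conj (A B : G -> Prop) :
    (forall x, A x -> H x) -> (forall x, B x -> K x) ->
    (forall x h, A x -> H h -> A (x ^ h)) ->
    (forall x k, B x -> K k -> B (x ^ k)) ->
  forall x y, mul_set A B x -> mul_set H K y -> mul_set A B (x ^ y).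
Proof.
move=> AH BK AJ BJ _ _ [a [b [Aa Bb ->]]] [h [k [Hh Kk ->]]].
by exists (a ^ h), (b ^ k); split; [exact: AJ|exact: BJ|apply: conj_commuting; auto].
Qed.

Lemma abelian_by_finite_mul : abelian_by_finite_in H -> abelian_by_finite_in K ->
  abelian_by_finite_in (mul_set H K).
Proof.
have [H1 HM HV] := Hsub; have [K1 KM KV] := Ksub.
move=> [A [Asub AH AJ Ac [s sP]]] [B [Bsub BK BJ Bc [t tP]]].
exists (mul_set A B); split.
- by apply: mul_set_subgroup; auto.
- exact: mul_set_sub.
- exact: mul_set_conj.
- move=> _ _ [a [b [Aa Bb ->]]] [c [d [Ac' Bd ->]]].
  have c1 : commute c (a * b).
    by apply: commuteM; [apply: Ac | apply: cHK; auto].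
  have c2 : commute d (a * b).
    by apply: commuteM; [apply/commute_sym/cHK; auto | apply: Bc].
  by apply: commuteM; apply: commute_sym.
- exists [seq g * h | g <- s, h <- t] => _ [x [y [Hx Ky ->]]].
  have [g gs [Hg Ag]] := sP x Hx; have [h ht [Kh Bh]] := tP y Ky.
  exists (g * h); [exact: allpairs_f | split; first by exists g, h].
  exists (g^-1 * x), (h^-1 * y); split=> //.
  rewrite (cHK Hg Kh) invgM -!mulgA; congr (_ * _).
  by rewrite !mulgA -(cHK Hx (KV _ Kh)).
Qed.

Lemma finite_by_abelian_mul : finite_by_abelian_in H -> finite_by_abelian_in K ->
  finite_by_abelian_in (mul_set H K).
Proof.
have [H1 HM HV] := Hsub; have [K1 KM KV] := Ksub.
move=> [E [Esub EH EJ [s sP] Ec]] [F [Fsub FK FJ [t tP] Fc]].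
exists (mul_set E F); split.
- by apply: mul_set_subgroup; auto.
- exact: mul_set_sub.
- exact: mul_set_conj.
- exists [seq g * h | g <- s, h <- t] => _ [x [y [/sP Hx /tP Ky ->]]].
  exact: allpairs_f.
- move=> _ _ [a [b [Ha Kb ->]]] [c [d [Hc Kd ->]]].
  (* As [H] and [K] commute, [[~ a * b, c * d]] splits as [[~ a, c] * [~ b, d]]. *)
  exists [~ a, c], [~ b, d]; split; auto.
  rewrite !commgEl conj_commuting // (cHK Ha Kb) invgM.
  have : commute (a ^ c) b^-1 by apply: cHK; [apply: subgroup_conj | apply: KV].
  move: (a ^ c) (b ^ d) => p q cpb.
  by rewrite -!mulgA (mulgA p) cpb -!mulgA.
Qed.

End Commuting.

End RelativeProperties.

(** * Permutation groups of arbitrary types *)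

Section Bijections.
Variable T : Type.

(** The symmetric group of an arbitrary type serves as a target of the universal property: an action
    of the graph product is a homomorphism into it. *)
Record bijection := Bijection {
  bij_fun :> T -> T; bij_inv : T -> T;
  bij_funK : cancel bij_fun bij_inv; bij_invK : cancel bij_inv bij_fun }.

HB.instance Definition _ := gen_eqMixin bijection.
HB.instance Definition _ := gen_choiceMixin bijection.

Lemma bijection_ext (f g : bijection) : f =1 g -> f = g.
Proof.
case: f g => [f f' fK f'K] [g g' gK g'K] /= fg.
have Ef : f = g by apply: funext.
have Eg : f' = g' by apply: funext => x; rewrite -{1}(g'K x) -fg fK.
by subst f' f; congr Bijection; apply: Prop_irrelevance.
Qed.

Definition bijection_mul (f g : bijection) :=
  Bijection (can_comp (bij_funK f) (bij_funK g))
            (can_comp (bij_invK g) (bij_invK f)).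
Definition bijection_one := @Bijection id id (fun=> erefl) (fun=> erefl).
Definition bijection_inv (f : bijection) := Bijection (bij_invK f) (bij_funK f).

Fact bijection_mulA : associative bijection_mul.
Proof. by move=> f g h; apply: bijection_ext. Qed.
Fact bijection_mul1 : left_id bijection_one bijection_mul.
Proof. by move=> f; apply: bijection_ext. Qed.
Fact bijection_mulr1 : right_id bijection_one bijection_mul.
Proof. by move=> f; apply: bijection_ext. Qed.
Fact bijection_mulV : left_inverse bijection_one bijection_inv bijection_mul.
Proof. by move=> f; apply: bijection_ext => x /=; rewrite bij_funK. Qed.
Fact bijection_mulrV : right_inverse bijection_one bijection_inv bijection_mul.
Proof. by move=> f; apply: bijection_ext => x /=; rewrite bij_invK. Qed.

HB.instance Definition _ := isGroup.Build bijection
  bijection_mulA bijection_mul1 bijection_mulr1 bijection_mulV bijection_mulrV.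

Lemma bijectionM (f g : bijection) x : (f * g) x = f (g x).
Proof. by []. Qed.

End Bijections.

(** * Retractions of a graph product *)

Section GraphProduct.
Variables (V : finType) (e : rel V) (Gv : V -> groupType) (GG : groupType).
Variable iota : forall v, Gv v -> GG.
Hypotheses (e_simple : simplicial e) (GGP : is_graph_product e iota).

Definition vertices_gen (P : V -> Prop) : GG -> Prop :=
  gen (fun x => exists v (g : Gv v), P v /\ x = iota g).

Let iotaM v : is_hom (@iota v). Proof. by case: GGP. Qed.

Lemma vertices_gen_mem (P : V -> Prop) v (g : Gv v) :
  P v -> vertices_gen P (iota g).
Proof. by move=> Pv; apply: gen_mem; exists v, g. Qed.

Lemma vertices_gen_sub (P P' : V -> Prop) x :
  (forall v, P v -> P' v) -> vertices_gen P x -> vertices_gen P' x.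
Proof.
move=> PP' Px; apply: Px; first exact: gen_subgroup.
by move=> _ [v [g [Pv ->]]]; apply: vertices_gen_mem; apply: PP'.
Qed.

Lemma vertices_gen_ind (P : V -> Prop) (Q : GG -> Prop) :
    Q 1 -> (forall v (g : Gv v) x, P v -> Q x -> Q (iota g * x)) ->
  forall x, vertices_gen P x -> Q x.
Proof.
move=> Q1 QM; apply: gen_ind_left => // [_ [v [g [Pv ->]]]|_ x [v [g [Pv ->]]]].
  by exists v, g^-1; rewrite homV.
exact: QM.
Qed.

(** The universal property gives a map into the subgroup generated by the vertex groups; composed
    with the inclusion it is the identity, by uniqueness. *)
Lemma graph_product_generated x : vertices_gen (fun=> True) x.
Proof.
have Ssub := gen_subgroup (fun x => exists v (g : Gv v), True /\ x = iota g).
pose f v (g : Gv v) := to_subgroup Ssub (@vertices_gen_mem (fun=> True) v g I).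
have [_ iotaC univ] := GGP.
have [|u w euw g h|psi [[psiM psiE] _]] := univ _ f.
- by move=> v g h; apply: val_inj; rewrite /= iotaM.
- by apply: val_inj; apply: iotaC.
have [psi' [_ uniq]] := univ _ iota iotaM iotaC.
have Eid : psi' = id by apply: uniq.
have Epsi : psi' = (fun x => val (psi x)).
  apply: uniq; split=> [y z|v g]; first by rewrite psiM.
  by rewrite psiE.
have -> : x = val (psi x) by rewrite -[RHS]/((fun x => val (psi x)) x) -Epsi Eid.
exact: subgroup_valP.
Qed.

Lemma graph_product_ind (Q : GG -> Prop) :
    Q 1 -> (forall v (g : Gv v) x, Q x -> Q (iota g * x)) -> forall x, Q x.
Proof.
move=> Q1 QM x; apply: (vertices_gen_ind Q1 _ (graph_product_generated x)).
by move=> v g y _; apply: QM.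
Qed.

Lemma graph_product_lift (H : groupType) u (f : Gv u -> H)
    (d : forall v, Gv v -> H) :
    is_hom f -> (forall v, v != u -> is_hom (d v)) ->
    (forall w, e u w -> forall g h, commute (f g) (d w h)) ->
    (forall v w, v != u -> w != u -> e v w -> forall g h, commute (d v g) (d w h)) ->
  exists psi : GG -> H, [/\ is_hom psi, forall g, psi (iota g) = f g
    & forall v (g : Gv v), v != u -> psi (iota g) = d v g].
Proof.
have [e_sym e_irr] := e_simple.
move=> fM dM cfd cdd; pose phi : forall v, Gv v -> H := dfwith d f.
have phiu : phi u = f by rewrite /phi dfwith_in.
have phid v : v != u -> phi v = d v by move=> vu; rewrite /phi dfwith_out // eq_sym.
have [_ _ univ] := GGP; have [v|v w evw g h|psi [[psiM psiE] _]] := univ H phi.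
- by have [->|vu] := eqVneq v u; [rewrite phiu | rewrite phid //; apply: dM].
- have [Ev|vu] := eqVneq v u; last first.
    have [Ew|wu] := eqVneq w u; last by rewrite !phid //; apply: cdd.
    move: h; rewrite Ew => h; rewrite phiu phid //; apply/commute_sym/cfd.
    by rewrite e_sym -Ew.
  have wu : w != u by apply/eqP => wu; rewrite Ev wu e_irr in evw.
  by move: g; rewrite Ev => g; rewrite phiu phid //; apply: cfd; rewrite -Ev.
exists psi; split=> // [g|v g vu]; first by rewrite psiE phiu.
by rewrite psiE phid.
Qed.

Lemma vertex_projection u : exists psi : GG -> Gv u,
  [/\ is_hom psi, forall g, psi (iota g) = g
    & forall v (g : Gv v), v != u -> psi (iota g) = 1].
Proof.
apply: (@graph_product_lift (Gv u) u id (fun v _ => 1)) => //.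
  by move=> v _ x y; rewrite mulg1.
by move=> w _ g h; apply: commute1.
Qed.

(** The projection onto [Gv v] kills the vertex groups of all other vertices but not [iota g]. *)
Lemma iota_notin_vertices_gen v (g : Gv v) (P : V -> Prop) :
  g != 1 -> ~ P v -> ~ vertices_gen P (iota g).
Proof.
move=> g1 nPv; have [psi [psiM psiv psi0]] := vertex_projection v.
suff H x : vertices_gen P x -> psi x = 1 by move/H/eqP; rewrite psiv (negPf g1).
elim/vertices_gen_ind => [|w h {}x Pw IHx]; first exact: hom1.
rewrite psiM IHx psi0 ?mulg1 //; apply/eqP => wv.
by apply: nPv; rewrite -wv.
Qed.

Lemma retraction_exists (P : pred V) : exists rho : GG -> GG,
  is_hom rho /\ forall v (g : Gv v), rho (iota g) = if P v then iota g else 1.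
Proof.
have [_ iotaC univ] := GGP.
have [v|u w euw g h|rho [rhoP _]] :=
  univ GG (fun v g => if P v then iota g else 1); last by exists rho.
  by move=> g h; case: ifP => _; rewrite ?mulg1 // iotaM.
case: ifP => _; last exact/commute_sym/commute1.
by case: ifP => _; [apply: iotaC | apply: commute1].
Qed.

Definition retraction P := proj1_sig (cid (retraction_exists P)).

Lemma retractionM P : is_hom (retraction P).
Proof. by rewrite /retraction; case: cid => rho []. Qed.

Lemma retractionE P v (g : Gv v) :
  retraction P (iota g) = if P v then iota g else 1.
Proof. by rewrite /retraction; case: cid => rho []. Qed.

Lemma retraction_id (P : pred V) x :
  vertices_gen (fun v => P v) x -> retraction P x = x.
Proof.
elim/vertices_gen_ind => [|v g {}x Pv IHx]; first exact/hom1/retractionM.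
by rewrite retractionM retractionE Pv IHx.
Qed.

(** An element fixed by two retractions is therefore fixed by the retraction onto the common
    vertices; this is how subgroups spanned by vertex sets get intersected. *)
Lemma retractionI (P P' : pred V) x :
  retraction P (retraction P' x) = retraction (predI P P') x.
Proof.
elim/graph_product_ind: x => [|v g x IHx];
  first by rewrite !hom1 //; apply: retractionM.
rewrite !retractionM IHx !retractionE /=; congr (_ * _).
by case: (P' v); rewrite ?andbT ?andbF ?retractionE // hom1 //; apply: retractionM.
Qed.

Lemma retraction_pred0 (P : pred V) x : P =1 pred0 -> retraction P x = 1.
Proof.
move=> P0; elim/graph_product_ind: x => [|v g x IHx]; first exact/hom1/retractionM.
by rewrite retractionM IHx retractionE P0 mulg1.
Qed.

End GraphProduct.

(** * Reduced words *)

(* Normal forms in the free product of copies of [B] indexed by the left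
   cosets of [C]: a letter [(p, b)] is the element [b] of the copy at the
   coset [p], cosets being encoded as predicates. *)
Section Words.
Variables (B G : groupType) (C : G -> Prop).
Hypothesis Csub : is_subgroup C.

Definition letter := ((G -> Prop) * B)%type.
Implicit Types (w t : seq letter) (b : B) (g : G) (p : G -> Prop).

Definition translate g p : G -> Prop := fun y => p (g^-1 * y).

Lemma translateM g h p : translate (g * h) p = translate g (translate h p).
Proof. by apply: funext => y; rewrite /translate invgM mulgA. Qed.

Lemma translate1 p : translate 1 p = p.
Proof. by apply: funext => y; rewrite /translate invg1 mul1g. Qed.

Lemma translate_inj g : injective (translate g).
Proof.
move=> p q /(congr1 (translate g^-1)).
by rewrite -!translateM mulVg !translate1.
Qed.

Lemma translate_base g : translate g C = C <-> C g.
Proof.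
split=> [E|Cg].
  by rewrite -E /translate mulVg; case: Csub.
apply: funext => y; apply: propext.
by apply: subgroup_mulr => //; apply/subgroup_inv.
Qed.

Definition reduced w :=
  all (fun l : letter => l.2 != 1) w &&
  sorted (fun l l' : letter => l.1 != l'.1) w.

Definition starts w := if w is (p, _) :: _ then p == C else false.

Definition head_syllable w :=
  if w is (p, b) :: _ then if p == C then b else 1 else 1.

Definition drop_syllable w :=
  if w is (p, b) :: t then if p == C then t else w else [::].

Definition add_syllable b w := if b == 1 then w else (C, b) :: w.

(** Left multiplication by the copy of [B] at the base coset [C]: the leading syllable there,
    counted as [1] if absent, absorbs [b] and vanishes when the product is trivial. *)
Definition mul_syllable b w :=
  add_syllable (b * head_syllable w) (drop_syllable w).

Definition translate_word g w := [seq (translate g l.1, l.2) | l <- w].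

Lemma head_add b w : ~~ starts w -> head_syllable (add_syllable b w) = b.
Proof.
rewrite /add_syllable; have [->|_] /= := eqVneq b 1; last by rewrite eqxx.
by case: w => [|[p c] w] //= /negPf->.
Qed.

Lemma drop_add b w : ~~ starts w -> drop_syllable (add_syllable b w) = w.
Proof.
rewrite /add_syllable; have [_|_] /= := eqVneq b 1; last by rewrite eqxx.
by case: w => [|[p c] w] //= /negPf->.
Qed.

Lemma add_head_drop w :
  reduced w -> add_syllable (head_syllable w) (drop_syllable w) = w.
Proof.
rewrite /add_syllable; case: w => [|[p b] w] /=; first by rewrite eqxx.
case/andP=> /andP[b1 _] _; have [->|//] := eqVneq p C; last by rewrite eqxx.
by rewrite (negPf b1).
Qed.

Lemma starts_drop w : reduced w -> ~~ starts (drop_syllable w).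
Proof.
case: w => [|[p b] w] //= /andP[_]; have [->|/negPf pC] := eqVneq p C.
  by case: w => [|[q c] w] //= /andP[qC _]; rewrite eq_sym.
by rewrite /= pC.
Qed.

Lemma reduced_drop w : reduced w -> reduced (drop_syllable w).
Proof.
case: w => [|[p b] w] //= rw; case: ifP => // _; move: rw.
by rewrite /reduced /= => /andP[/andP[_ ->] /path_sorted->].
Qed.

Lemma reduced_add b w : reduced w -> ~~ starts w -> reduced (add_syllable b w).
Proof.
rewrite /add_syllable; have [//|b1] := eqVneq b 1.
rewrite /reduced /= => /andP[-> sw] nw; rewrite b1 /=.
by case: w sw nw => [|[p c] w] //= ->; rewrite eq_sym => ->.
Qed.

Lemma reduced_mul b w : reduced w -> reduced (mul_syllable b w).
Proof. by move=> rw; rewrite reduced_add ?reduced_drop ?starts_drop. Qed.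

Lemma mul_syllableM b c w :
  reduced w -> mul_syllable (b * c) w = mul_syllable b (mul_syllable c w).
Proof.
move=> rw; rewrite /mul_syllable head_add ?starts_drop //.
by rewrite drop_add ?starts_drop // mulgA.
Qed.

Lemma mul_syllable1 w : reduced w -> mul_syllable 1 w = w.
Proof. by move=> rw; rewrite /mul_syllable mul1g add_head_drop. Qed.

Lemma starts_mul b w : b != 1 -> ~~ starts w -> starts (mul_syllable b w).
Proof.
move=> b1 nw; rewrite /mul_syllable.
have -> : head_syllable w = 1 by case: w nw => [|[p c] w] //= /negPf->.
by rewrite mulg1 /add_syllable (negPf b1) /= eqxx.
Qed.

Lemma reduced_translate g w : reduced w -> reduced (translate_word g w).
Proof.
rewrite /reduced all_map sorted_map => /andP[-> sw] /=.
move: sw; apply: sub_sorted => l l' /=.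
by apply: contra_neq => /translate_inj.
Qed.

Lemma translate_wordM g h w :
  translate_word (g * h) w = translate_word g (translate_word h w).
Proof.
by rewrite /translate_word -map_comp; apply: eq_map => l; rewrite /= translateM.
Qed.

Lemma translate_word1 w : translate_word 1 w = w.
Proof. by rewrite -[RHS]map_id; apply: eq_map => -[p b]; rewrite /= translate1. Qed.

Lemma starts_translate_base g w : C g -> starts (translate_word g w) = starts w.
Proof.
move=> /translate_base Eg; case: w => [|[p b] w] //=.
by rewrite -{1}Eg (inj_eq (@translate_inj g)).
Qed.

Lemma starts_translate g w :
  ~ C g -> starts w -> ~~ starts (translate_word g w).
Proof.
case: w => [|[p b] w] //= nCg /eqP->.
by apply/eqP => /translate_base.
Qed.

(** Translation by an element of [C] fixes the base coset. This provides the relations between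
    [Gv u] and its link in the action on words. *)
Lemma mul_translate b g w : C g ->
  mul_syllable b (translate_word g w) = translate_word g (mul_syllable b w).
Proof.
move=> /translate_base Eg; rewrite /mul_syllable.
have EC p : (translate g p == C) = (p == C).
  by rewrite -{1}Eg (inj_eq (@translate_inj g)).
have Ea c t : translate_word g (add_syllable c t) =
    add_syllable c (translate_word g t).
  by rewrite /add_syllable; case: eqP => //= _; rewrite Eg.
rewrite Ea; case: w => [|[p c] w] //=.
by rewrite EC; case: eqP.
Qed.

Definition rword := {w | reduced w}.

Definition rword_mul b (x : rword) : rword :=
  Sub (mul_syllable b (val x)) (reduced_mul b (valP x)).

Definition rword_translate g (x : rword) : rword :=
  Sub (translate_word g (val x)) (reduced_translate g (valP x)).

Lemma rword_mulM b c x : rword_mul (b * c) x = rword_mul b (rword_mul c x).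
Proof. by apply: val_inj; rewrite /= mul_syllableM ?(valP x). Qed.

Lemma rword_mul1 x : rword_mul 1 x = x.
Proof. by apply: val_inj; rewrite /= mul_syllable1 ?(valP x). Qed.

Lemma rword_translateM g h x :
  rword_translate (g * h) x = rword_translate g (rword_translate h x).
Proof. by apply: val_inj; apply: translate_wordM. Qed.

Lemma rword_translate1 x : rword_translate 1 x = x.
Proof. by apply: val_inj; apply: translate_word1. Qed.

Fact rword_mulK b : cancel (rword_mul b) (rword_mul b^-1).
Proof. by move=> x; rewrite -rword_mulM mulVg rword_mul1. Qed.
Fact rword_mulKV b : cancel (rword_mul b^-1) (rword_mul b).
Proof. by move=> x; rewrite -rword_mulM mulgV rword_mul1. Qed.

Fact rword_translateK g : cancel (rword_translate g) (rword_translate g^-1).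
Proof. by move=> x; rewrite -rword_translateM mulVg rword_translate1. Qed.
Fact rword_translateKV g : cancel (rword_translate g^-1) (rword_translate g).
Proof. by move=> x; rewrite -rword_translateM mulgV rword_translate1. Qed.

Definition mul_bijection b := Bijection (rword_mulK b) (rword_mulKV b).

Definition translate_bijection g :=
  Bijection (rword_translateK g) (rword_translateKV g).

Lemma mul_bijectionM : is_hom mul_bijection.
Proof. by move=> b c; apply: bijection_ext => x; apply: rword_mulM. Qed.

Lemma translate_bijectionM : is_hom translate_bijection.
Proof. by move=> g h; apply: bijection_ext => x; apply: rword_translateM. Qed.

Lemma mul_translate_commute b g :
  C g -> commute (mul_bijection b) (translate_bijection g).
Proof.
move=> Cg; apply: bijection_ext => x; apply: val_inj.
exact: mul_translate.
Qed.

End Words.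

(** * The half-space of a vertex *)

Section HalfSpace.
Variables (V : finType) (e : rel V) (Gv : V -> groupType) (GG : groupType).
Variable iota : forall v, Gv v -> GG.
Hypotheses (e_simple : simplicial e) (GGP : is_graph_product e iota).
Variable u : V.

Definition link_group := vertices_gen iota (fun v => e u v).
Definition rest_group := vertices_gen iota (fun v => v != u).

(* [X] consists of the elements having a normal form that starts with a
   nontrivial syllable of [Gv u]; in the Bass-Serre tree of
   [rest_group *_link_group (link_group * Gv u)] it is a side of the edge
   fixed by [link_group]. *)
Definition half_space (X : GG -> Prop) :=
  [/\ [/\ ~ X 1 & forall x a, rest_group a -> X (x * a) <-> X x],
      forall x c, link_group c -> X (c * x) <-> X x,
      forall x a, rest_group a -> ~ link_group a -> X x -> ~ X (a * x)
    & forall x (b : Gv u), b != 1 -> ~ X x -> X (iota b * x)].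

Lemma link_rest x : link_group x -> rest_group x.
Proof.
apply: vertices_gen_sub => v euv; apply/eqP => vu.
by have [_ irr] := e_simple; rewrite vu irr in euv.
Qed.

(** The graph product acts on reduced words: [Gv u] multiplies the leading syllable at the base
    coset, while the other vertex groups translate the cosets. [X] collects the elements that send
    the empty word to a word starting at the base coset; it is invariant on the right because
    [rest_group] fixes the empty word. *)
Lemma half_space_exists : exists X, half_space X.
Proof.
have [iotaM iotaC _] := GGP.
have Csub : is_subgroup link_group by apply: gen_subgroup.
pose B := Gv u.
have [|v vu||v w vu wu evw g h|psi [psiM psiu psiv]] :=
  graph_product_lift e_simple GGP (u := u) (f := @mul_bijection B GG link_group)
    (d := fun v (g : Gv v) => @translate_bijection B GG (iota g)).
- exact: mul_bijectionM.
- by move=> g h; rewrite iotaM translate_bijectionM.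
- move=> w euw g h; apply: mul_translate_commute => //.
  exact: vertices_gen_mem.
- rewrite /commute -!translate_bijectionM; congr translate_bijection.
  exact: iotaC.
have psi_rest a : rest_group a -> psi a = translate_bijection B a.
  elim/(vertices_gen_ind GGP) => [|v g x vu IHx].
    by rewrite !hom1 //; apply: translate_bijectionM.
  by rewrite psiM psiv // IHx translate_bijectionM.
pose w0 : rword B GG := Sub [::] isT.
pose X x := starts link_group (val (psi x w0)).
exists X; split; [split | | |] => [|x a Ra|x c Cc|x a Ra nCa Xx|x b b1 /negP nXx].
- by rewrite /X hom1.
- rewrite /X psiM bijectionM (psi_rest a) //.
  by have -> : translate_bijection B a w0 = w0 by apply: val_inj.
- rewrite /X psiM bijectionM (psi_rest c); last exact: link_rest.
  by rewrite starts_translate_base.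
- apply/negP; rewrite /X psiM bijectionM (psi_rest a) //.
  exact: starts_translate.
- by rewrite /X psiM bijectionM psiu; apply: starts_mul.
Qed.

End HalfSpace.

(** * Nestedness and crossings of half-spaces *)

Section HalfSpaceTheory.
Variables (V : finType) (e : rel V) (Gv : V -> groupType) (GG : groupType).
Variable iota : forall v, Gv v -> GG.
Hypotheses (e_simple : simplicial e) (GGP : is_graph_product e iota).
Variables (u : V) (X : GG -> Prop).
Hypothesis XP : half_space e iota u X.

Let C := link_group e iota u.
Let A := rest_group iota u.
Let Csub : is_subgroup C. Proof. exact: gen_subgroup. Qed.
Let Asub : is_subgroup A. Proof. exact: gen_subgroup. Qed.
Let CA x : C x -> A x. Proof. exact: link_rest. Qed.
Let iotaM v : is_hom (@iota v). Proof. by case: GGP. Qed.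

Let nX1 : ~ X 1. Proof. by case: XP => -[]. Qed.
Let XA x a : A a -> X (x * a) <-> X x.
Proof. by case: XP => -[_ H] _ _ _; apply: H. Qed.
Let XC x c : C c -> X (c * x) <-> X x. Proof. by case: XP => _ H _ _; apply: H. Qed.
Let XnC x a : A a -> ~ C a -> X x -> ~ X (a * x).
Proof. by case: XP => _ _ H _; apply: H. Qed.
Let Xb x (b : Gv u) : b != 1 -> ~ X x -> X (iota b * x).
Proof. by case: XP => _ _ _ H; apply: H. Qed.

Lemma half_space_rest a : A a -> ~ X a.
Proof. by move=> Aa; rewrite -(mul1g a) XA. Qed.

Lemma link_commute (b : Gv u) c : C c -> commute (iota b) c.
Proof.
have [_ iotaC _] := GGP.
elim/(vertices_gen_ind GGP) => [|v g x euv IHx]; first exact: commute1.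
by apply: commuteM => //; apply: iotaC.
Qed.

(** Reduced expressions of the amalgam that start on the [Gv u] side: nontrivial syllables of [Gv u]
    alternate with elements of [A] outside [C], only the final factor being allowed in [C]. *)
Inductive alternating : GG -> Prop :=
| alternating_base (b : Gv u) a : b != 1 -> A a -> alternating (iota b * a)
| alternating_step (b : Gv u) x r : b != 1 -> A x -> ~ C x ->
    alternating r -> alternating (iota b * (x * r)).

Lemma alternating_link c r : C c -> alternating r -> alternating (c * r).
Proof.
have [_ AM _] := Asub.
move=> Cc [b a b1 Aa|b x {}r b1 Ax nCx altr]; rewrite mulgA -link_commute // -mulgA.
  by apply: alternating_base => //; apply: AM => //; apply: CA.
rewrite (mulgA c); apply: alternating_step => //; first by apply: AM => //; apply: CA.
by rewrite subgroup_mulr.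
Qed.

(** Ping-pong, read from the right: elements of [A] outside [C] throw [X] into its complement, and
    nontrivial syllables throw the complement into [X]. *)
Lemma alternating_half_space r : alternating r -> X r.
Proof.
elim=> [b a b1 Aa|b x {}r b1 Ax nCx _ Xr]; apply: Xb => //.
  exact: half_space_rest.
exact: XnC.
Qed.

Lemma alternating_cover g : A g \/ exists x r, [/\ A x, alternating r & g = x * r].
Proof.
have [A1 AM AV] := Asub.
elim/(graph_product_ind GGP): g => [|v g x IHx]; first by left.
have [Ev|vu] := eqVneq v u; last first.
  have Ag : A (iota g) by apply: vertices_gen_mem.
  case: IHx => [Ax|[y [r [Ay altr ->]]]]; first by left; apply: AM.
  by right; exists (iota g * y), r; rewrite mulgA; split=> //; apply: AM.
move: g; rewrite {}Ev => b; have [->|b1] := eqVneq b 1.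
  by rewrite hom1 // mul1g.
have altb a : A a -> alternating (iota b * a) by move=> ?; apply: alternating_base.
case: IHx => [Ax|[y [r [Ay altr ->]]]].
  by right; exists 1, (iota b * x); rewrite mul1g; split; auto.
have [Cy|nCy] := pselect (C y); last first.
  right; exists 1, (iota b * (y * r)); rewrite mul1g; split=> //.
  exact: alternating_step.
(* Since [y] is in [C] it is absorbed, and [b] meets the leading syllable [c]. If they cancel, what
   follows [c] is again of one of the two desired forms. *)
case: (alternating_link Cy altr) => [c a c1 Aa|c z {y Ay Cy altr}r' c1 Az nCz altr'].
  rewrite mulgA -iotaM; have [->|bc] := eqVneq (b * c) 1.
    by left; rewrite hom1 // mul1g.
  right; exists 1, (iota (b * c) * a); rewrite mul1g; split=> //.
  exact: alternating_base.
rewrite mulgA -iotaM; have [->|bc] := eqVneq (b * c) 1.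
  by right; rewrite hom1 // mul1g; exists z, r'.
right; exists 1, (iota (b * c) * (z * r')); rewrite mul1g; split=> //.
exact: alternating_step.
Qed.

Lemma alternating_mulr r (s : Gv u) : alternating r ->
  A (r * iota s) \/ alternating (r * iota s).
Proof.
have [A1 AM AV] := Asub.
have [->|s1] := eqVneq s 1; first by rewrite hom1 // mulg1; right.
elim=> [b a b1 Aa|b x {}r b1 Ax nCx _ IHr]; last first.
  rewrite -!mulgA; right; case: IHr => [Ars|altrs].
    by apply: alternating_base => //; apply: AM.
  exact: alternating_step.
(* If the final factor lies in [C], then [s] passes it and merges with the last syllable; otherwise
   [s] is a new syllable, with final factor [1]. *)
have [Ca|nCa] := pselect (C a).
  rewrite -mulgA -link_commute // mulgA -iotaM.
  have [->|bs] := eqVneq (b * s) 1; first by left; rewrite hom1 // mul1g.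
  by right; apply: alternating_base.
right; rewrite -mulgA -[iota s]mulg1; apply: alternating_step => //.
exact: alternating_base.
Qed.

(** If [h] begins with a factor of [A] outside [C], then [h * iota s] either still does so before an
    alternating product or falls into [A]; in both cases it stays outside [X]. *)
Lemma half_space_edge h (s : Gv u) : ~ X h -> X (h * iota s) -> C h.
Proof.
have [A1 AM AV] := Asub; move=> nXh Xhs; apply: contrapT => nCh.
have [s1|s1] := eqVneq s 1; first by rewrite s1 hom1 // mulg1 in Xhs.
have [Ah|[x [r [Ax altr Eh]]]] := alternating_cover h.
  by apply: (XnC Ah nCh) Xhs; rewrite -[iota s]mulg1; apply: Xb.
have nCx : ~ C x.
  move=> Cx; apply: nXh; rewrite Eh; apply: alternating_half_space.
  exact: alternating_link.
move: Xhs; rewrite Eh -mulgA; case: (alternating_mulr s altr) => [Ars|altrs].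
  by apply: half_space_rest; apply: AM.
by apply: XnC => //; apply: alternating_half_space.
Qed.

(** Removing the leading syllable [c] of [n], if any, leaves an element outside [X]. Commutation
    turns right multiplication by [b] into left multiplication by a conjugate of [b], which leads
    into [X], so [half_space_edge] applies. *)
Lemma centralizer_in_star n (b : Gv u) :
  b != 1 -> commute n (iota b) -> exists c : Gv u, C (iota c * n).
Proof.
move=> b1 cnb.
suff [c nXc] : exists c : Gv u, ~ X (iota c^-1 * n).
  exists c^-1; apply: (@half_space_edge _ b) => //.
  have -> : iota c^-1 * n * iota b = iota (b ^ c) * (iota c^-1 * n).
    by rewrite homJ // conjgE -!mulgA homV // mulVKg cnb.
  by apply: Xb; rewrite ?conjg_eq1.
have [Xn|nXn] := pselect (X n); last by exists 1; rewrite invg1 hom1 // mul1g.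
have [/half_space_rest//|[x [r [Ax altr En]]]] := alternating_cover n.
have [Cx|nCx] := pselect (C x); last first.
  by rewrite En in Xn; case: (XnC Ax nCx (alternating_half_space altr)).
have := alternating_link Cx altr; rewrite -En.
case=> [c a _ Aa|c y r' _ Ay nCy altr']; exists c; rewrite homV // mulKg.
  exact: half_space_rest.
by apply: XnC => //; apply: alternating_half_space.
Qed.

(** The final factor decides: in [C] it preserves the complement of [X], outside [C] it sends [X]
    into that complement. The last syllable then leads into [X], and every earlier pair of factors
    maps [X] into itself. *)
Lemma alternating_nested r : alternating r ->
  (forall x, X x -> X (r * x)) \/ (forall x, ~ X x -> X (r * x)).
Proof.
elim=> [b a b1 Aa|b y {}r b1 Ay nCy _ [IHr|IHr]].
- have [Ca|nCa] := pselect (C a).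
    by right=> x nXx; rewrite -mulgA; apply: Xb => //; rewrite XC.
  by left=> x Xx; rewrite -mulgA; apply: Xb => //; apply: XnC.
- by left=> x Xx; rewrite -!mulgA; apply: Xb => //; apply: XnC => //; apply: IHr.
- by right=> x Xx; rewrite -!mulgA; apply: Xb => //; apply: XnC => //; apply: IHr.
Qed.

(** An alternating product sends [X] or its complement into [X]; a leading factor of [A] outside [C]
    then carries the result into the complement. *)
Lemma half_space_nested g : C g \/
  [\/ forall x, X x -> X (g * x), forall x, X x -> ~ X (g * x),
      forall x, ~ X x -> X (g * x) | forall x, ~ X x -> ~ X (g * x)].
Proof.
have [Cg|nCg] := pselect (C g); [by left | right].
have [Ag|[y [r [Ay altr ->]]]] := alternating_cover g.
  by apply: Or42 => x; apply: XnC.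
have [Cy|nCy] := pselect (C y).
  have [H|H] := alternating_nested (alternating_link Cy altr).
    exact: Or41.
  exact: Or43.
have [H|H] := alternating_nested altr; [apply: Or42 | apply: Or44] => x Xx;
  by rewrite -mulgA; apply: XnC => //; apply: H.
Qed.

(* The edges of the tree between [h] and [h * z] are finitely many, uniformly
   in [h]. *)
Lemma half_space_crossing z : exists L : seq GG, forall h,
  ~ (X h <-> X (h * z)) -> exists2 l, l \in L & C (h * l).
Proof.
elim/(graph_product_ind GGP): z => [|v g z [L LP]].
  by exists [::] => h; rewrite mulg1 => -[].
exists (1 :: iota g :: [seq iota g * l | l <- L]) => h nXh.
have [XE|nXE] := pselect (X h <-> X (h * iota g)).
  have [|l lL Cl] := LP (h * iota g); first by rewrite -mulgA -XE.
  by exists (iota g * l); rewrite ?mulgA // !inE map_f ?orbT.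
have vu : v = u.
  apply/eqP/negPn/negP => vu; apply: nXE; rewrite XA //.
  exact: vertices_gen_mem.
move: g nXE {nXh}; rewrite {}vu => g nXE.
(* Entering [X] forces [h] into [C], whence the entry [1] of the list; leaving [X] is entering it
   backwards along [g^-1], whence the entry [iota g]. *)
have [Xh|nXh] := pselect (X h); last first.
  exists 1; rewrite ?mem_head // mulg1; apply: (@half_space_edge _ g) => //.
  by apply: contrapT => nXhg; apply: nXE; split.
exists (iota g); first by rewrite !inE eqxx orbT.
apply: (@half_space_edge _ g^-1).
  by move=> Xhg; apply: nXE; split.
by rewrite homV // mulgK.
Qed.

Lemma half_space_crossing_seq (s : seq GG) : exists L : seq GG, forall z h,
  z \in s -> ~ (X h <-> X (h * z)) -> exists2 l, l \in L & C (h * l).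
Proof.
elim: s => [|z s [L LP]]; first by exists [::].
have [L' LP'] := half_space_crossing z.
exists (L' ++ L) => y h; rewrite inE => /predU1P[->|ys] nXh.
  by have [l lL Cl] := LP' h nXh; exists l; rewrite // mem_cat lL.
by have [l lL Cl] := LP y h ys nXh; exists l; rewrite // mem_cat lL orbT.
Qed.

(** * Cosets of a normal subgroup cross the half-space *)

Section NormalSubgroup.
Variable N : GG -> Prop.
Hypothesis Nnormal : is_normal N.
Variable b : Gv u.
Hypothesis b1 : b != 1.

Let Nsub : is_subgroup N. Proof. by case: Nnormal. Qed.

(* All translates of the edge by [N] lie between [w] and [w'], and they are
   linearly ordered by nestedness; hence [N] fixes them. *)
Lemma separated_in_link w w' :
    (forall n, N n -> ~ X (n * w)) -> (forall n, N n -> X (n * w')) ->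
  forall n, N n -> C n.
Proof.
have [N1 NM NV] := Nsub; move=> nXw Xw'.
have [L LP] := half_space_crossing (w^-1 * w').
(* The elements [n^-1 * w] and [n^-1 * w'] are on opposite sides of [X], so [n] lies in one of
   finitely many left cosets of [C]. *)
have NL n : N n -> exists2 g, g \in [seq w * l | l <- L] & C (g^-1 * n).
  move=> Nn; have [|l lL Cl] := LP (n^-1 * w).
    rewrite -mulgA mulVKg => -[_ H].
    exact: nXw (NV _ Nn) (H (Xw' _ (NV _ Nn))).
  exists (w * l); first exact: map_f.
  by rewrite -subgroup_inv // invgM invgK mulgA.
(* Some positive power of [m] lies in [C] and preserves [X], so the inclusion given by [m] is an
   equality. Hence [m] and [m * iota b] are separated by [X], as [1] and [iota b] are, and
   [half_space_edge] applies. *)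
have fixed m : N m -> (forall x, X x -> X (m * x)) -> C m.
  move=> Nm Xm; have [k|p [p_gt0 _ Cp]] :=
    expg_pigeonhole (x := m) (s := [seq w * l | l <- L]) Csub.
    exact: NL (subgroup_exp k Nsub Nm).
  have Xexp k x : X x -> X (m ^+ k * x).
    by elim: k => [|k IHk] Xx; rewrite ?mul1g // expgS -mulgA; apply: Xm; apply: IHk.
  have Xinv x : X (m * x) -> X x.
    move/(Xexp p.-1); rewrite mulgA -expgSr prednK // => Xx.
    by rewrite -(XC x Cp).
  apply: (@half_space_edge m b); first by rewrite -{1}(mulg1 m) => /Xinv.
  by apply: Xm; rewrite -[iota b]mulg1; apply: Xb.
(* The two inclusions that exchange sides contradict the positions of [w'] and [w]; the last one is
   the first one for [n^-1]. *)
move=> n Nn; have [//|[H|H|H|H]] := half_space_nested n.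
- exact: fixed.
- have Xw1 : X w' by rewrite -(mul1g w'); apply: Xw'.
  by case: (H w' Xw1); apply: Xw'.
- by case: (nXw n) => //; apply: H; rewrite -(mul1g w); apply: nXw.
- rewrite -subgroup_inv //; apply: fixed => [|x Xx]; first exact: NV.
  by apply: contrapT => /H; rewrite mulVKg.
Qed.

Hypothesis NnC : ~ forall n, N n -> C n.
Variable a : GG.
Hypotheses (Aa : A a) (nCa : ~ C a).

(** If the coset [N w] missed [X], normality would put all [n * (iota b * w) = iota b * (n ^ iota b
    * w)] into [X], so [w] and [iota b * w] would be separated for all of [N]. *)
Lemma normal_meets_half_space w : exists2 n, N n & X (n * w).
Proof.
have [N1 NM NV] := Nsub; have [_ NJ] := Nnormal.
apply: contrapT => noX; apply: NnC.
have nX n : N n -> ~ X (n * w) by move=> Nn Xn; apply: noX; exists n.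
apply: (@separated_in_link w (iota b * w)) => // n Nn.
rewrite mulgA [n * _]conjgC -mulgA; apply: Xb => //; apply: nX; exact: NJ.
Qed.

(** The dual argument, with [a] carrying [X] into its complement in place of [iota b]. *)
Lemma normal_meets_opposite w : exists2 n, N n & ~ X (n * w).
Proof.
have [N1 NM NV] := Nsub; have [_ NJ] := Nnormal.
apply: contrapT => noX; apply: NnC.
have inX n : N n -> X (n * w).
  by move=> Nn; apply: contrapT => nXn; apply: noX; exists n.
apply: (@separated_in_link (a * w) w) => // n Nn.
rewrite mulgA [n * _]conjgC -mulgA; apply: XnC => //; apply: inX; exact: NJ.
Qed.

(** [L] records the crossings of the finitely many generators of [N]. If it failed at [g], no
    generator would cross [X] along the coset [g N], which would lie on one side; but this coset is
    [N g], which meets both. *)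
Lemma normal_link_cocompact : finitely_generated N ->
  exists L : seq GG, forall g, exists l n, [/\ l \in L, N n & C (g * n * l)].
Proof.
have [N1 NM NV] := Nsub; have [_ NJ] := Nnormal.
move=> [s sP]; have [L LP] := half_space_crossing_seq s; exists L => g.
apply: contrapT => noL.
have constX n t : N n -> t \in s -> X (g * n) <-> X (g * n * t).
  move=> Nn ts; apply: contrapT => /(LP _ _ ts)[l lL Cl].
  by apply: noL; exists l, n.
have gN m : N m -> forall n, N n -> X (g * n) <-> X (g * (n * m)).
  move=> Nm; suff [] : N m /\ forall n, N n -> X (g * n) <-> X (g * (n * m)) by [].
  apply: ((sP m).1 Nm (fun m => N m /\
    forall n, N n -> X (g * n) <-> X (g * (n * m)))) => [|t ts]; last first.
    by split=> [|n Nn]; [apply/sP; apply: gen_mem | rewrite mulgA; apply: constX].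
  split=> [|x y [Nx Hx] [Ny Hy]|x [Nx Hx]].
  - by split=> // n Nn; rewrite mulg1.
  - split=> [|n Nn]; first exact: NM.
    by rewrite (Hx n Nn) (Hy (n * x)) ?mulgA //; apply: NM.
  - split=> [|n Nn]; first exact: NV.
    have Nnx : N (n * x^-1) by apply: NM => //; apply: NV.
    by rewrite (Hx _ Nnx) mulgVK.
have [n Nn Xn] := normal_meets_half_space g.
have [m Nm nXm] := normal_meets_opposite g.
apply: nXm; rewrite conjgC -(mul1g (m ^ g)); apply/(gN _ (NJ _ g Nm) _ N1).
rewrite mulg1; have := gN _ (NJ _ g Nn) _ N1.
by rewrite mul1g mulg1 -conjgC => ->.
Qed.

Lemma link_image_finite_index (Q : groupType) (pi : GG -> Q) :
    finitely_generated N -> is_hom pi -> (forall q, exists x, pi x = q) ->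
    (forall x, pi x = 1 <-> N x) ->
  finite_index (fun q => exists2 c, C c & pi c = q).
Proof.
move=> Nfg piM pi_surj kerpi; have [L LP] := normal_link_cocompact Nfg.
exists (map pi L) => q; have [x <-] := pi_surj q.
(* Starting from [x^-1], inversion produces [l^-1 * n^-1 * x] in [C], whose image is
   [(pi l)^-1 * pi x]. *)
have [l [n [lL Nn Cl]]] := LP x^-1; exists (pi l); first exact: map_f.
exists (l^-1 * n^-1 * x).
  by rewrite -subgroup_inv // !invgM !invgK mulgA.
by rewrite !piM !(homV _ piM) (kerpi n).2 // invg1 mulg1.
Qed.

End NormalSubgroup.

End HalfSpaceTheory.

(** * Full normal subgroups *)

Section FullNormal.
Variables (V : finType) (e : rel V) (Gv : V -> groupType) (GG : groupType).
Variable iota : forall v, Gv v -> GG.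
Hypotheses (e_simple : simplicial e) (GGP : is_graph_product e iota).
Hypothesis Gv_nontrivial : forall v, exists g : Gv v, g != 1.
Variable N : GG -> Prop.
Hypothesis Nnormal : is_normal N.

Let iotaM v : is_hom (@iota v). Proof. by case: GGP. Qed.

Definition star v : pred V := [pred w | (w == v) || e v w].

(** This expresses that [N] lies in the subgroup spanned by the star of [v], in a form to which
    [retractionI] applies. *)
Definition in_star v := forall n, N n -> retraction GGP (star v) n = n.

(** The retraction onto the star of [v] fixes [n] and its conjugate by [iota a], but kills [iota a];
    so the conjugate equals [n]. *)
Lemma in_star_commute v w : in_star v -> w != v -> ~~ e v w ->
  forall n (a : Gv w), N n -> commute n (iota a).
Proof.
move=> Nv wv evw n a Nn; apply/commgP/conjg_fixP.
have [_ NJ] := Nnormal; have := Nv _ (NJ _ (iota a) Nn).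
rewrite (homJ _ _ (retractionM GGP _)) retractionE /star /= (negPf wv) (negPf evw).
by rewrite conjg1 Nv.
Qed.

Lemma link_in_star v x : link_group e iota v x -> retraction GGP (star v) x = x.
Proof.
move=> Cx; apply: retraction_id; apply: vertices_gen_sub Cx => w evw.
by rewrite /star /= evw orbT.
Qed.

(** Each [n] is a product of an element of [Gv w] and one of the link group, by
    [centralizer_in_star]. *)
Lemma centralizing_in_star w :
  (forall n (a : Gv w), N n -> commute n (iota a)) -> in_star w.
Proof.
move=> cN n Nn; have [b b1] := Gv_nontrivial w.
have [X XP] := half_space_exists e_simple GGP w.
have [c /link_in_star Cc] :=
  centralizer_in_star e_simple GGP XP b1 (cN n b Nn).
have cs : retraction GGP (star w) (iota c) = iota c.
  by rewrite retractionE /star /= eqxx.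
by move: Cc; rewrite retractionM cs => /mulgI.
Qed.

(** Along an edge of the complement graph, lying in one star forces commutation with the next vertex
    group, which forces lying in the next star. *)
Lemma in_star_cocomp u v : in_star u -> cocomp e u v -> in_star v.
Proof.
move=> Nu /connectP[p + ->]; elim: p u Nu => //= w p IHp u Nu.
case/andP=> /andP[uw euw] pth; apply: IHp pth; apply: centralizing_in_star.
by apply: in_star_commute Nu _ euw; rewrite eq_sym.
Qed.

Lemma cocomp_neighbour u z0 z : z0 != u -> ~~ e u z0 -> cocomp e u z ->
  exists w, [/\ cocomp e u w, z != w & ~~ e w z].
Proof.
have [e_sym _] := e_simple; move=> z0u euz0 /connectP[p + ->].
case/lastP: p => [_|p y].
  exists z0; rewrite eq_sym z0u e_sym; split=> //.
  by apply: connect1; rewrite /= eq_sym z0u.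
rewrite rcons_path last_rcons => /andP[pth /andP[ly ely]].
exists (last u p); split=> //; last by rewrite eq_sym.
by apply/connectP; exists p.
Qed.

(** Otherwise [N] lies in the star subgroup of every vertex of the join factor of [u]. The
    nontrivial element of [N] that fullness gives in this factor is then fixed by the retraction
    onto the factor intersected with all these stars, a set that is empty by [cocomp_neighbour]. *)
Lemma full_normal_notin_link u z0 : full e iota N -> z0 != u -> ~~ e u z0 ->
  ~ forall n, N n -> link_group e iota u n.
Proof.
move=> Nfull z0u euz0 NC; have [n [n1 Nn nu]] := Nfull u.
have Nstar v : cocomp e u v -> in_star v.
  by apply: in_star_cocomp => m Nm; apply: link_in_star; apply: NC.
have [P nP Pstar] : exists2 P : pred V, retraction GGP P n = n & forall z, P z ->
    cocomp e u z /\ forall v, v \in enum V -> cocomp e u v -> star v z.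
  elim: (enum V) => [|v r [P nP Pr]].
    by exists (cocomp e u) => //; apply: retraction_id.
  have [uv|nuv] := boolP (cocomp e u v).
    exists (predI (star v) P); first by rewrite -retractionI nP Nstar.
    move=> z /andP[vz /Pr[uz rz]]; split=> // w.
    by rewrite inE => /predU1P[->|/rz].
  exists P => // z /Pr[uz rz]; split=> // w; rewrite inE => /predU1P[->|/rz//].
  by rewrite (negPf nuv).
move: n1; rewrite -nP retraction_pred0 ?eqxx // => z.
apply/negP => /Pstar[uz /(_ _ (mem_enum V _)) zstar].
have [w [uw zw ewz]] := cocomp_neighbour z0u euz0 uz.
by have := zstar w uw; rewrite /star /= (negPf zw) (negPf ewz).
Qed.

End FullNormal.

(** * Quotients *)

Section Transfer.
Variables (G : groupType) (S : G -> Prop) (Ssub : is_subgroup S).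
Let T := subgroup_type Ssub.

Definition push (A : T -> Prop) (x : G) := exists2 t : T, A t & val t = x.

Lemma push_subgroup A : is_subgroup A -> is_subgroup (push A).
Proof.
move=> [A1 AM AV]; split=> [|_ _ [s As <-] [t At <-]|_ [t At <-]].
- by exists 1.
- by exists (s * t) => //; apply: AM.
- by exists t^-1 => //; apply: AV.
Qed.

Lemma push_normal A : is_normal A ->
  [/\ is_subgroup (push A), forall x, push A x -> S x
    & forall x h, push A x -> S h -> push A (x ^ h)].
Proof.
move=> [Asub AJ]; split; first exact: push_subgroup.
- by move=> _ [t _ <-]; apply: subgroup_valP.
- move=> _ h [t At <-] Sh; exists (t ^ to_subgroup Ssub Sh) => //.
  exact: AJ.
Qed.

Lemma abelian_by_finite_subgroup :
  abelian_by_finite T -> abelian_by_finite_in S.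
Proof.
move=> [A [/push_normal[pA pS pJ] Ac [s sP]]]; exists (push A); split=> //.
- by move=> _ _ [a Aa <-] [b Ab <-]; apply: (congr1 val (Ac a b Aa Ab)).
- exists (map val s) => x Sx; have [g gs Ag] := sP (to_subgroup Ssub Sx).
  exists (val g); first exact: map_f.
  by split; [apply: subgroup_valP | exists (g^-1 * to_subgroup Ssub Sx)].
Qed.

Lemma finite_by_abelian_subgroup :
  finite_by_abelian T -> finite_by_abelian_in S.
Proof.
move=> [F [/push_normal[pF pS pJ] [s sP] Fc]]; exists (push F); split=> //.
- by exists (map val s) => _ [t /sP ts <-]; apply: map_f.
- move=> x y Sx Sy.
  by exists [~ to_subgroup Ssub Sx, to_subgroup Ssub Sy].
Qed.

End Transfer.

Lemma abelian_by_finite_total (G : groupType) (H : G -> Prop) :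
  (forall x, H x) -> abelian_by_finite_in H -> abelian_by_finite G.
Proof.
move=> HT [A [Asub _ AJ Ac [s sP]]]; exists A; split=> //.
  by split=> // x g Ax; apply: AJ.
by exists s => x; have [g gs []] := sP x (HT x); exists g.
Qed.

Lemma finite_by_abelian_total (G : groupType) (H : G -> Prop) :
  (forall x, H x) -> finite_by_abelian_in H -> finite_by_abelian G.
Proof.
move=> HT [F [Fsub _ FJ Ffin Fc]]; exists F; split=> //.
  by split=> // x g Fx; apply: FJ.
by move=> x y; apply: Fc.
Qed.

(** The intersection of [H] and [K] is central and of finite index in [H]; it is the abelian
    subgroup sought, and [schur] supplies the finite one. *)
Lemma central_by_finite_in (G : groupType) (H K : G -> Prop) :
    is_subgroup H -> is_subgroup K -> finite_index K ->
    (forall x y, H x -> K y -> commute x y) ->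
  abelian_by_finite_in H /\ finite_by_abelian_in H.
Proof.
move=> Hsub Ksub Kfi cHK; pose Z x := H x /\ K x.
have [[H1 HM HV] [K1 KM KV]] := (Hsub, Ksub).
have Zsub : is_subgroup Z.
  split=> [|x y [Hx Kx] [Hy Ky]|x [Hx Kx]]; split; auto.
have ZC z x : Z z -> H x -> commute z x.
  by move=> [_ Kz] Hx; apply/commute_sym/cHK.
have Zfi : finite_index_in H Z.
  have [s sP] := finite_index_inI H Ksub Kfi; exists s => x Hx.
  by have [g gs [Hg Kg]] := sP x Hx; exists g => //; do !split=> //; auto.
split; last by apply: (schur Hsub Zsub ZC Zfi).
exists Z; split=> // [x []|x h Zx Hh|x y Zx [Hy _]] //; last exact: ZC.
by have -> : x ^ h = x by apply/conjg_fixP/commgP/ZC.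
Qed.

(** * Images of the vertex groups in the quotient *)

Section Quotient.
Variables (V : finType) (e : rel V) (Gv : V -> groupType) (GG : groupType).
Variable iota : forall v, Gv v -> GG.
Hypotheses (e_simple : simplicial e) (GGP : is_graph_product e iota).
Hypothesis Gv_nontrivial : forall v, exists g : Gv v, g != 1.
Variable N : GG -> Prop.
Hypotheses (Nnormal : is_normal N) (Nfg : finitely_generated N).
Hypothesis Nfull : full e iota N.
Variables (Q : groupType) (pi : GG -> Q).
Hypotheses (piM : is_hom pi) (pi_surj : forall q, exists x, pi x = q).
Hypothesis kerpi : forall x, pi x = 1 <-> N x.

Let iotaM v : is_hom (@iota v). Proof. by case: GGP. Qed.

Definition noncentral v := [exists w, (w != v) && ~~ e v w].

Lemma centralP v : ~~ noncentral v -> central_vertex e v.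
Proof.
by move=> /existsPn nv w wv; have := nv w; rewrite wv negbK.
Qed.

Definition vertex_image v (q : Q) := exists g : Gv v, q = pi (iota g).

Lemma vertex_image_subgroup v : is_subgroup (vertex_image v).
Proof.
split=> [|_ _ [g ->] [h ->]|_ [g ->]].
- by exists 1; rewrite (hom1 (@iotaM v)) (hom1 piM).
- by exists (g * h); rewrite iotaM piM.
- by exists g^-1; rewrite (homV _ (@iotaM v)) (homV _ piM).
Qed.

Lemma centralizer_finite_index u : noncentral u ->
  finite_index (fun q => forall a, vertex_image u a -> commute a q).
Proof.
case/existsP=> z /andP[zu euz].
have NnC := full_normal_notin_link e_simple GGP Gv_nontrivial Nnormal Nfull zu euz.
have [X XP] := half_space_exists e_simple GGP u.
have [b b1] := Gv_nontrivial u; have [a a1] := Gv_nontrivial z.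
(* A vertex [z] not adjacent to [u] supplies the element of [rest_group] outside [link_group]. *)
have Aa : rest_group iota u (iota a) by apply: vertices_gen_mem.
have nCa : ~ link_group e iota u (iota a).
  by apply: (iota_notin_vertices_gen e_simple GGP a1); apply/negP.
apply: finite_index_sub (link_image_finite_index e_simple GGP XP Nnormal b1 NnC
  Aa nCa Nfg piM pi_surj kerpi) => _ [c Cc <-] _ [g ->].
by rewrite /commute -!piM (link_commute GGP g Cc).
Qed.

(** All noncentral vertices are always included; [r] lists the central ones added so far, for an
    induction on [r]. *)
Definition image_gen (r : seq V) : Q -> Prop :=
  gen (fun q => exists2 v, noncentral v || (v \in r) & vertex_image v q).

Lemma image_gen_commute (r : seq V) v : ~~ noncentral v -> v \notin r ->
  forall x y, image_gen r x -> vertex_image v y -> commute x y.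
Proof.
move=> nv vr x y rx vy; apply: (gen_commute _ rx (gen_mem vy)).
move=> _ _ [w wr [g ->]] [h ->]; have [_ iotaC _] := GGP.
rewrite /commute -!piM (iotaC w v) //; have [e_sym _] := e_simple.
rewrite e_sym; apply: centralP => //.
by apply: contraTneq wr => ->; rewrite negb_or nv.
Qed.

Lemma image_gen_cons r v :
  ~~ noncentral v -> v \notin r ->
  image_gen (v :: r) = mul_set (image_gen r) (vertex_image v).
Proof.
move=> nv vr; have cr := image_gen_commute nv vr.
have Vsub := vertex_image_subgroup v.
have rsub : is_subgroup (image_gen r) by apply: gen_subgroup.
have [V1 _ _] := Vsub; have [r1 _ _] := rsub.
apply: funext => q; apply: propext; split.
  apply=> [|_ [w + [g ->]]]; first exact: mul_set_subgroup.
  rewrite inE orbCA => /predU1P[Ew|wr].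
    by exists 1, (pi (iota g)); rewrite mul1g; split=> //; rewrite -Ew; exists g.
  exists (pi (iota g)), 1; rewrite mulg1; split=> //.
  by apply: gen_mem; exists w => //; exists g.
move=> [h [k [rh vk ->]]]; apply: gen_mul; last first.
  by apply: gen_mem; exists v; rewrite // mem_head orbT.
apply: rh; first exact: gen_subgroup.
move=> a [w wr wa]; apply: gen_mem; exists w => //.
by case/orP: wr => wr; rewrite ?inE wr ?orbT.
Qed.

Lemma image_gen_total q : image_gen [seq v <- enum V | ~~ noncentral v] q.
Proof.
have [x <-] := pi_surj q.
elim/(graph_product_ind GGP): x => [|v g x IHx]; first by rewrite hom1 //; apply: gen1.
rewrite piM; apply: gen_mul => //; apply: gen_mem; exists v; last by exists g.
by rewrite mem_filter mem_enum andbT orbN.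
Qed.

(** The centralizers of the images of the noncentral vertex groups have finite index, hence so does
    their finite intersection, which centralizes everything these images generate. *)
Lemma image_gen_nil : abelian_by_finite_in (image_gen [::]) /\
  finite_by_abelian_in (image_gen [::]).
Proof.
pose K v q := forall a, vertex_image v a -> commute a q.
have Ksub v : is_subgroup (K v) by apply: subgroup_cent.
apply: (@central_by_finite_in _ _ (fun q => forall v, noncentral v -> K v q)).
- exact: gen_subgroup.
- split=> [v _|x y Kx Ky v nv|x Kx v nv]; have [K1 KM KV] := Ksub v; first exact: K1.
    by apply: KM; [apply: Kx | apply: Ky].
  by apply: KV; apply: Kx.
- by apply: finite_index_bigcap => v nv //; apply: centralizer_finite_index.
move=> x y rx Ky; apply: (gen_commute _ rx (gen_mem (erefl y))) => a _ [v + va] <-.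
by rewrite in_nil orbF => nv; apply: Ky va.
Qed.

(** A central vertex is isolated in the complement graph, so it is its own join factor and fullness
    provides a nontrivial element of [N] in its vertex group. *)
Lemma central_vertex_kernel v : ~~ noncentral v ->
  exists g : Gv v, g != 1 /\ pi (iota g) = 1.
Proof.
move=> nv; have [x [x1 Nx vx]] := Nfull v.
have [g Ex] : exists g : Gv v, x = iota g.
  apply: (vx (fun x => exists g : Gv v, x = iota g)) => [|_ [w [g [vw ->]]]].
    split=> [|_ _ [g ->] [h ->]|_ [g ->]].
    - by exists 1; rewrite (hom1 (@iotaM v)).
    - by exists (g * h); rewrite iotaM.
    - by exists g^-1; rewrite (homV _ (@iotaM v)).
  suff Ew : w = v by move: g; rewrite Ew => g; exists g.
  case/connectP: vw => -[//|y p] /= /andP[/andP[vy evy] _] _.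
  by rewrite eq_sym in vy; rewrite centralP in evy.
exists g; split; last by rewrite -Ex; apply/kerpi.
by apply: contraNneq x1 => g1; rewrite Ex g1 hom1.
Qed.

Hypothesis central_quotients : forall v, central_vertex e v ->
  forall (Q' : groupType) (pi' : Gv v -> Q'),
    is_hom pi' -> (forall q, exists g, pi' g = q) ->
    (exists g, g != 1 /\ pi' g = 1) ->
    abelian_by_finite Q' /\ finite_by_abelian Q'.

Lemma central_vertex_image v : ~~ noncentral v ->
  abelian_by_finite_in (vertex_image v) /\ finite_by_abelian_in (vertex_image v).
Proof.
move=> nv; have Vsub := vertex_image_subgroup v.
have mem (g : Gv v) : vertex_image v (pi (iota g)) by exists g.
have [|||+ +] := central_quotients (centralP nv)
  (pi' := fun g => to_subgroup Vsub (mem g)).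
- by move=> g h; apply: val_inj; rewrite /= iotaM piM.
- move=> q; have [g Eg] := subgroup_valP q.
  by exists g; apply: val_inj.
- have [g [g1 Eg]] := central_vertex_kernel nv.
  by exists g; split=> //; apply: val_inj.
by move=> /abelian_by_finite_subgroup + /finite_by_abelian_subgroup.
Qed.

Lemma image_gen_properties r : uniq r -> all (predC noncentral) r ->
  abelian_by_finite_in (image_gen r) /\ finite_by_abelian_in (image_gen r).
Proof.
elim: r => [_ _|v r IHr]; first exact: image_gen_nil.
rewrite /= => /andP[vr /IHr{}IHr] /andP[nv /IHr[IHA IHF]].
have [VA VF] := central_vertex_image nv.
have rsub : is_subgroup (image_gen r) by apply: gen_subgroup.
have Vsub := vertex_image_subgroup v; have cr := image_gen_commute nv vr.
rewrite image_gen_cons //; split.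
  exact: abelian_by_finite_mul.
exact: finite_by_abelian_mul.
Qed.

End Quotient.

Theorem theorem2p5 (V : finType) (e : rel V) (Gv : V -> groupType)
    (GG : groupType) (iota : forall v, Gv v -> GG) (N : GG -> Prop) :
  simplicial e ->
  is_graph_product e iota ->
  (forall v, exists g : Gv v, g != 1) ->
  is_normal N ->
  finitely_generated N ->
  full e iota N ->
  (forall v, central_vertex e v ->
     forall (Q : groupType) (pi : Gv v -> Q),
       is_hom pi -> (forall q, exists g, pi g = q) ->
       (exists g, g != 1 /\ pi g = 1) ->
       abelian_by_finite Q /\ finite_by_abelian Q) ->
  forall (Q : groupType) (pi : GG -> Q),
    is_hom pi -> (forall q, exists x, pi x = q) ->
    (forall x, pi x = 1 <-> N x) ->
    finite_by_abelian Q /\ abelian_by_finite Q.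
Proof.
move=> e_simple GGP nontriv Nnormal Nfg Nfull centralQ Q pi piM pi_surj kerpi.
(* With all central vertices listed, [image_gen] is the whole of [Q]. *)
pose r := [seq v <- enum V | ~~ noncentral e v].
have [||IHA IHF] := image_gen_properties e_simple GGP nontriv Nnormal Nfg Nfull
  piM pi_surj kerpi centralQ (r := r).
- by rewrite filter_uniq ?enum_uniq.
- exact: filter_all.
have total := image_gen_total GGP piM pi_surj.
split; first exact: finite_by_abelian_total IHF.
exact: abelian_by_finite_total IHA.
Qed.
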